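(* Let $\{(\mathbf c^{n},\mathbf f^{n})\}_{n\ge 0}$ be a numerical solution computed by the predictor-corrector full discretization described in the context (so that, at every time level, the pair $(\mathbf c^n,\mathbf f^n)$ satisfies the discrete continuity-of-solution and continuity-of-traction interface conditions). Then the fully discrete energy $$ \begin{aligned} E^{n+1/2} ={}& \left((\varrho^h)^{1/2}D_t\mathbf f^n,(\varrho^h)^{1/2}D_t\mathbf f^n\right)_{hw}+\left((\varrho^{2h})^{1/2}D_t\mathbf c^n,(\varrho^{2h})^{1/2}D_t\mathbf c^n\right)_{2hw}\\ &+\mathcal S_{2h}(\mathbf c^{n+1},\mathbf c^n)+\mathcal S_h(\mathbf f^{n+1},\mathbf f^n)\\ &-\frac{\Delta_t^2}{12}\left((\mathcal J^h)^{-1}\hat{\mathcal L}^h\mathbf f^{n+1},(\mathcal J^h_\rho)^{-1}\hat{\mathcal L}^h\mathbf f^n\right)_{hw}-\frac{\Delta_t^2}{12}\left((\mathcal J^{2h})^{-1}\widetilde{\mathcal L}^{2h}\mathbf c^{n+1},(\mathcal J^{2h}_\rho)^{-1}\widetilde{\mathcal L}^{2h}\mathbf c^n\right)_{2hw} \end{aligned} $$ is nonnegative under the time step restriction $$ \Delta_t\le\min\left\{\frac{2\sqrt3}{\max_j\sqrt{\kappa^h_j}},\ \frac{2\sqrt3}{\max_j\sqrt{\kappa^{2h}_j}}\right\}, $$ where $\kappa_j^h$ and $\kappa_j^{2h}$ are the $j$-th eigenvalues of the matrices $\bar K_h$ and $\bar K_{2h}$, respectively.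
   Context: **Continuous data.** The 2D elastic wave equation is posed in two subdomains $\Omega^c$ (coarse, below) and $\Omega^f$ (fine, above), images of $[0,1]^2\ni(r,s)$ under smooth one-to-one maps $\mathbf X^c,\mathbf X^f$ with Jacobians $J^c,J^f>0$. The interface $\Gamma$ is $s=1$ for $\Omega^c$ and $s=0$ for $\Omega^f$. For $\ast\in\{c,f\}$: $\rho^\ast>0$ is the density; $N^\ast_{kj}$ ($k,j=1,2$) are $2\times2$ matrix-valued material functions with $N^\ast_{kk}$ symmetric positive definite and $N^\ast_{kj}=(N^\ast_{jk})^T$; $\Lambda^\ast=\sqrt{(\partial s/\partial x)^2+(\partial s/\partial y)^2}>0$. The equations are $\rho^\ast J^\ast\mathbf U_{tt}=\partial_r(N^\ast_{11}\mathbf U_r)+\partial_r(N^\ast_{12}\mathbf U_s)+\partial_s(N^\ast_{21}\mathbf U_r)+\partial_s(N^\ast_{22}\mathbf U_s)$. **Grids.** $h_1(n_1^h-1)=1=h_2(n_2^h-1)$ and $2h_1(n_1^{2h}-1)=1=2h_2(n_2^{2h}-1)$. $I_{\Omega^c}=\{1\le i\le n_1^{2h},1\le j\le n_2^{2h}\}$, $I_{\Gamma^c}=\{j=n_2^{2h}\}$ in it; $I_{\Omega^f}=\{1\le i\le n_1^{h},1\le j\le n_2^{h}\}$, $I_{\Gamma^f}=\{j=1\}$ in it. Grid functions take values in $\mathbb R^2$. The vector $\mathbf f$ has values on $I_{\Omega^f}$ (no ghost points); $\mathbf c$ has values on $I_{\Omega^c}$ and additionally on the line of ghost points $j=n_2^{2h}+1$.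 Inner products and the forms $\mathcal S$ below use only non-ghost values. A tilde over an operator means it uses ghost points. **One-dimensional operators.** On a uniform grid $x_1,\dots,x_n$ with spacing $h$, $(u,v)_{hw1}=h\sum_{j=1}^n\omega_ju_jv_j$ with weights $\omega_j>0$. A first derivative SBP operator $D$ satisfies $(u,Dv)_{hw1}=-(Du,v)_{hw1}-u_1v_1+u_nv_n$. A second derivative SBP operator $G(\gamma)\approx\frac{d}{dx}(\gamma\frac{d}{dx})$ satisfies $(u,G(\gamma)v)_{hw1}=-S_\gamma(u,v)-\gamma_1u_1b_1v+\gamma_nu_nb_nv$ with $S_\gamma$ symmetric positive semidefinite, not using ghost points, and $b_1v,b_nv$ approximating the first derivative at $x_1,x_n$. It is written $G$ if no ghost points are used, and $\widetilde G$ if ghost points are used (in $b_1,b_n$ and the first/last row). **Two-dimensional operators.** Subscript 1 (resp. 2) denotes application along grid lines in $r$ (resp. $s$); superscripts $h,2h$ denote fine/coarse grid; matrix coefficients act componentwise, e.g. $(G_1(N_{11})\mathbf u)_p=\sum_{q=1}^2G_1(N_{11}(p,q))u^{(q)}$. Define $$\widetilde{\mathcal L}^{2h}\mathbf c=G_1^{2h}(N_{11}^{2h})\mathbf c+\widetilde G_2^{2h}(N_{22}^{2h})\mathbf c+D_1^{2h}(N_{12}^{2h}D_2^{2h}\mathbf c)+D_2^{2h}(N_{21}^{2h}D_1^{2h}\mathbf c),$$ $$\mathcal L^{h}\mathbf f=G_1^{h}(N_{11}^{h})\mathbf f+G_2^{h}(N_{22}^{h})\mathbf f+D_1^{h}(N_{12}^{h}D_2^{h}\mathbf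 f)+D_2^{h}(N_{21}^{h}D_1^{h}\mathbf f),$$ and, on $\Gamma$, the traction operators $\widetilde{\mathcal A}_2^{2h}\mathbf c=N_{21}^{2h}D_1^{2h}\mathbf c+N_{22}^{2h}\widetilde{\mathcal D}_2^{2h}\mathbf c$ and $\mathcal A_2^h\mathbf f=N_{21}^hD_1^h\mathbf f+N_{22}^h\mathcal D_2^h\mathbf f$, where $\widetilde{\mathcal D}^{2h}_2$, $\mathcal D_2^h$ are the boundary first derivative approximations ($b_n$ at $s=1$ with ghost points, $b_1$ at $s=0$ without) associated with $\widetilde G_2^{2h}$, $G_2^h$. **Diagonal matrices and inner products.** $\mathbf I$ is the $2\times 2$ identity. $J^h,\rho^h$ (resp. $J^{2h},\rho^{2h}$) are diagonal matrices of grid values of $J^f,\rho^f$ (resp. $J^c,\rho^c$). For $g\in\{h,2h\}$: $\mathcal J^g=J^g\otimes\mathbf I$, $\varrho^g=\rho^g\otimes\mathbf I$, $\mathcal J_\rho^g=(\rho^gJ^g)\otimes\mathbf I$, $\mathcal J^g_{\Gamma\Lambda}=(J^g_\Gamma\Lambda^g)\otimes\mathbf I$ (grid values of $J$ and $\Lambda$ on $\Gamma$). $W^g$ is the diagonal matrix with entry $\omega_i\omega_j$ at grid point $(i,j)$ (products of the 1D SBP weights), $\mathcal W^g=W^g\otimes\mathbf I$, and $\mathcal W_\Gamma^g=W^g_\Gamma\otimes\mathbf I$ with $W_\Gamma^g=\mathrm{diag}(\omega_i)$ the 1D weights along $\Gamma$. Inner products: $(\mathbf v,\mathbf u)_{hw}=h_1h_2\mathbf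 v^T\mathcal W^h\mathcal J^h\mathbf u$, $(\mathbf v,\mathbf u)_{2hw}=4h_1h_2\mathbf v^T\mathcal W^{2h}\mathcal J^{2h}\mathbf u$; on $\Gamma$: $\langle\mathbf u,\mathbf v\rangle_{hw}=h_1\mathbf u^T\mathcal W_\Gamma^h\mathcal J^h_{\Gamma\Lambda}\mathbf v$, $\langle\mathbf u,\mathbf v\rangle_{2hw}=2h_1\mathbf u^T\mathcal W_\Gamma^{2h}\mathcal J^{2h}_{\Gamma\Lambda}\mathbf v$. **Summation-by-parts identities.** All contributions from physical boundaries (boundaries other than $\Gamma$) are omitted throughout. With this convention the spatial operators satisfy, for all grid functions ($\mathbf v|_\Gamma$ being the restriction to the interface), $$(\mathbf v,(\mathcal J^{2h})^{-1}\widetilde{\mathcal L}^{2h}\mathbf u)_{2hw}=-\mathcal S_{2h}(\mathbf v,\mathbf u)+\langle\mathbf v|_\Gamma,(\mathcal J_{\Gamma\Lambda}^{2h})^{-1}\widetilde{\mathcal A}_2^{2h}\mathbf u\rangle_{2hw},$$ $$(\mathbf v,(\mathcal J^{h})^{-1}\mathcal L^{h}\mathbf u)_{hw}=-\mathcal S_{h}(\mathbf v,\mathbf u)-\langle\mathbf v|_\Gamma,(\mathcal J_{\Gamma\Lambda}^{h})^{-1}\mathcal A_2^{h}\mathbf u\rangle_{hw},$$ where $\mathcal S_{2h},\mathcal S_h$ are symmetric positive semidefinite bilinear forms not involving ghost points. **Interpolation.** $P$ ($n_1^h\times n_1^{2h}$) and $R$ ($n_1^{2h}\times n_1^h$) are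 interpolation and restriction matrices satisfying the compatibility condition $h_1\,v_f^TW_\Gamma^hPv_c=2h_1\,v_c^TW_\Gamma^{2h}Rv_f$ for all $v_c,v_f$. Scaled operators: $\mathcal P=(\mathcal J_{\Gamma\Lambda}^h)^{-1/2}(P\otimes\mathbf I)(\mathcal J_{\Gamma\Lambda}^{2h})^{1/2}$, $\mathcal R=(\mathcal J_{\Gamma\Lambda}^{2h})^{-1/2}(R\otimes\mathbf I)(\mathcal J_{\Gamma\Lambda}^{h})^{1/2}$. $\mathcal P(\mathbf c)$ means $\mathcal P$ applied to $\mathbf c|_\Gamma$. **Interface quantities.** For $(\mathbf c,\mathbf f)$ let $\boldsymbol\eta=\mathcal J^h_\rho|_\Gamma\,\mathcal P\big((\mathcal J^{2h}_\rho)^{-1}\widetilde{\mathcal L}^{2h}\mathbf c|_\Gamma\big)-\mathcal L^h\mathbf f|_\Gamma$, and let $\hat{\mathcal L}^h\mathbf f$ be $\mathcal L^h\mathbf f+\boldsymbol\eta$ on $I_{\Gamma^f}$ and $\mathcal L^h\mathbf f$ on $I_{\Omega^f}\setminus I_{\Gamma^f}$ (so $\hat{\mathcal L}^h\mathbf f$ depends on the accompanying $\mathbf c$). The discrete interface conditions are (continuity of solution) $\mathbf f|_\Gamma=\mathcal P(\mathbf c)$; (continuity of traction) $(\mathcal J_{\Gamma\Lambda}^{2h})^{-1}\widetilde{\mathcal A}_2^{2h}\mathbf c=\mathcal R\big((\mathcal J_{\Gamma\Lambda}^h)^{-1}(\mathcal A_2^h\mathbf f-h_2\omega_1\boldsymbol\eta)\big)$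 on $I_{\Gamma^c}$, where $\omega_1$ is the 1D SBP weight at the first grid point. **Full discretization** (step size $\Delta_t>0$, no forcing). Given $(\mathbf c^{n-1},\mathbf f^{n-1})$ and $(\mathbf c^n,\mathbf f^n)$ satisfying both interface conditions: 1. $\mathbf c^{\ast,n+1}=2\mathbf c^n-\mathbf c^{n-1}+\Delta_t^2(\mathcal J^{2h}_\rho)^{-1}\widetilde{\mathcal L}^{2h}\mathbf c^n$ on $I_{\Omega^c}$; $\mathbf f^{\ast,n+1}=2\mathbf f^n-\mathbf f^{n-1}+\Delta_t^2(\mathcal J^{h}_\rho)^{-1}\hat{\mathcal L}^{h}\mathbf f^n$ on $I_{\Omega^f}\setminus I_{\Gamma^f}$. 2. $\mathbf f^{\ast,n+1}|_\Gamma=\mathcal P(\mathbf c^{\ast,n+1})$. 3. The ghost values of $\mathbf c^{\ast,n+1}$ are determined by the continuity of traction for $(\mathbf c^{\ast,n+1},\mathbf f^{\ast,n+1})$. 4. $\mathbf a_c^n=(\mathbf c^{\ast,n+1}-2\mathbf c^n+\mathbf c^{n-1})/\Delta_t^2$, $\mathbf a_f^n=(\mathbf f^{\ast,n+1}-2\mathbf f^n+\mathbf f^{n-1})/\Delta_t^2$ at all grid points (including ghost points for $\mathbf a_c^n$). 5. $\mathbf c^{n+1}=\mathbf c^{\ast,n+1}+\frac{\Delta_t^4}{12}(\mathcal J^{2h}_\rho)^{-1}\widetilde{\mathcal L}^{2h}\mathbf a_c^n$ on $I_{\Omega^c}$; $\mathbf f^{n+1}=\mathbf f^{\ast,n+1}+\frac{\Delta_t^4}{12}(\mathcal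 J^{h}_\rho)^{-1}\hat{\mathcal L}^{h}\mathbf a_f^n$ on $I_{\Omega^f}\setminus I_{\Gamma^f}$. 6. $\mathbf f^{n+1}|_\Gamma=\mathcal P(\mathbf c^{n+1})$. 7. The ghost values of $\mathbf c^{n+1}$ are determined by the continuity of traction for $(\mathbf c^{n+1},\mathbf f^{n+1})$. The ghost-point systems in steps 3 and 7 are assumed solvable. **Notation in the energy.** $D_t\mathbf c^n=(\mathbf c^{n+1}-\mathbf c^n)/\Delta_t$, and likewise for $\mathbf f$. $K_h,K_{2h}$ are the square matrices with $\mathcal S_h(\mathbf v,\mathbf u)=(\mathbf v,\varrho^hK_h\mathbf u)_{hw}$ and $\mathcal S_{2h}(\mathbf v,\mathbf u)=(\mathbf v,\varrho^{2h}K_{2h}\mathbf u)_{2hw}$ for all grid functions. $\bar K_h=(\mathcal W^h_\rho)^{1/2}K_h(\mathcal W_\rho^h)^{-1/2}$, $\bar K_{2h}=(\mathcal W^{2h}_\rho)^{1/2}K_{2h}(\mathcal W_\rho^{2h})^{-1/2}$, with $\mathcal W_\rho^g=(\rho^gW^g)\otimes\mathbf I$; their eigenvalues are real and nonnegative. *)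

(* Defs.v *)
Set Warnings "-all".
From HB Require Import structures.
From mathcomp Require Import all_boot all_order all_algebra.
From mathcomp Require Import all_classical all_reals all_analysis.

Set Implicit Arguments.
Unset Strict Implicit.
Unset Printing Implicit Defensive.

Import Order.TTheory GRing.Theory Num.Theory.
Import numFieldNormedType.Exports.

Local Open Scope classical_set_scope.
Local Open Scope ring_scope.

Section Continuous.
Variable R : realType.

Definition unit_square : set 'rV[R]_2 := [set p | forall k, 0 <= p ord0 k <= 1].

(* C^oo on an open neighbourhood of the closed square: every iterated partial
   derivative is (Frechet) differentiable there. *)
Definition smooth_on_square (X : 'rV[R]_2 -> 'rV[R]_2) : Prop :=
  exists U : set 'rV[R]_2,
    [/\ open U, unit_square `<=` U
      & forall (ks : seq 'I_2) (p : 'rV[R]_2), U p ->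
          differentiable
            (foldr (fun k (g : 'rV[R]_2 -> 'rV[R]_2) q =>
                      'D_(delta_mx ord0 k) g q) X ks) p].

(* Points of the parameter domain are row vectors (r, s), and
   Nmat k j is N_{k+1,j+1}. *)
Record subdomain := Subdomain {
  Xmap : 'rV[R]_2 -> 'rV[R]_2;
  rho  : 'rV[R]_2 -> R;
  Nmat : 'I_2 -> 'I_2 -> 'rV[R]_2 -> 'M[R]_2
}.

Definition Jac (d : subdomain) (p : 'rV[R]_2) : R := \det (jacobian (Xmap d) p).

(* [jacobian] acts on row vectors: its (i, j) entry is the derivative of the
   j-th component of X along the i-th parameter. The inverse matrix is the
   Jacobian matrix of (x, y) |-> (r, s), whose last column is (s_x, s_y). *)
Definition Lam (d : subdomain) (p : 'rV[R]_2) : R :=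
  let Q := invmx (jacobian (Xmap d) p) in
  Num.sqrt (Q 0 1 ^+ 2 + Q 1 1 ^+ 2).

Definition sym_posdef (A : 'M[R]_2) : Prop :=
  A^T = A /\ forall x : 'cV[R]_2, x != 0 -> 0 < (x^T *m A *m x) 0 0.

Definition subdomain_ok (d : subdomain) : Prop :=
  [/\ smooth_on_square (Xmap d),
      set_inj unit_square (Xmap d)
    & forall p, unit_square p ->
        [/\ 0 < Jac d p, 0 < rho d p, 0 < Lam d p,
            forall k, sym_posdef (Nmat d k k p)
          & forall k j, Nmat d k j p = (Nmat d j k p)^T]].

Definition side (s : R) : set 'rV[R]_2 :=
  [set p | unit_square p /\ p 0 1 = s].

End Continuous.

Section OneDim.
Variable R : realType.

(* Operators on a line of n.+1 grid points. The second derivative and the two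
   boundary derivatives read m values, namely the n.+1 grid values and possibly
   ghost values. *)
Record line_op (n m : nat) := LineOp {
  wt  : 'rV[R]_n.+1;
  D   : 'M[R]_n.+1;
  G   : 'rV[R]_n.+1 -> 'M[R]_(n.+1, m);
  b1  : 'rV[R]_m;
  bn  : 'rV[R]_m;
  Sg  : 'rV[R]_n.+1 -> 'M[R]_n.+1
}.

(* [e] embeds the grid points into the points where values are read.
   [lft] and [rgt] tell whether the corresponding end of the line lies on the
   interface. An end on a physical boundary contributes nothing, since the
   contributions of physical boundaries are omitted throughout. *)
Definition is_sbp (n m : nat) (e : 'I_n.+1 -> 'I_m) (h : R) (lft rgt : bool)
    (o : line_op n m) : Prop :=
  let ip (u v : 'cV[R]_n.+1) := h * \sum_(j < n.+1) wt o 0 j * u j 0 * v j 0 in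
  [/\ forall j, 0 < wt o 0 j,
      forall u v : 'cV[R]_n.+1,
        ip u (D o *m v) = - ip (D o *m u) v
          - (u ord0 0 * v ord0 0) *+ lft
          + (u ord_max 0 * v ord_max 0) *+ rgt,
      forall (gam : 'rV[R]_n.+1) (u : 'cV[R]_n.+1) (v : 'cV[R]_m),
        ip u (G o gam *m v) = - (u^T *m Sg o gam *m rowsub e v) 0 0
          - (gam 0 ord0 * u ord0 0 * (b1 o *m v) 0 0) *+ lft
          + (gam 0 ord_max * u ord_max 0 * (bn o *m v) 0 0) *+ rgt,
      forall gam : 'rV[R]_n.+1, (Sg o gam)^T = Sg o gam
    & forall gam : 'rV[R]_n.+1, (forall j, 0 < gam 0 j) ->
        forall u : 'cV[R]_n.+1, 0 <= (u^T *m Sg o gam *m u) 0 0].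

End OneDim.

Section GridFunctions.
Variable R : realType.

Definition gridfun (m n : nat) := 'I_m -> 'I_n -> 'cV[R]_2.
Definition linefun (m : nat) := 'I_m -> 'cV[R]_2.

Definition dot2 (x y : 'cV[R]_2) : R := (x^T *m y) 0 0.

Definition along1 (m m' n : nat) (A : 'M[R]_(m, m')) (u : gridfun m' n)
  : gridfun m n := fun i j => \sum_k A i k *: u k j.

Definition along2 (m n n' : nat) (A : 'M[R]_(n, n')) (u : gridfun m n')
  : gridfun m n := fun i j => \sum_k A j k *: u i k.

Definition Gmat1 (m m' n : nat) (G1 : 'rV[R]_m -> 'M[R]_(m, m'))
    (N : 'I_m -> 'I_n -> 'M[R]_2) (u : gridfun m' n) : gridfun m n :=
  fun i j => \col_p \sum_q \sum_k G1 (\row_l N l j p q) i k * u k j q 0.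

Definition Gmat2 (m n n' : nat) (G2 : 'rV[R]_n -> 'M[R]_(n, n'))
    (N : 'I_m -> 'I_n -> 'M[R]_2) (u : gridfun m n') : gridfun m n :=
  fun i j => \col_p \sum_q \sum_k G2 (\row_l N i l p q) j k * u i k q 0.

Definition matmul (m n : nat) (N : 'I_m -> 'I_n -> 'M[R]_2) (u : gridfun m n)
  : gridfun m n := fun i j => N i j *m u i j.

(* Grid functions as column vectors, so that matrices such as K_h act on them. *)
Definition dof (m n : nat) : finType := ('I_m * 'I_n * 'I_2)%type.

Definition vec (m n : nat) (u : gridfun m n) : 'cV[R]_#|dof m n| :=
  \col_a let: (i, j, p) := enum_val a in u i j p 0.

Definition unvec (m n : nat) (x : 'cV[R]_#|dof m n|) : gridfun m n :=
  fun i j => \col_p x (enum_rank ((i, j, p) : dof m n)) 0.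

Definition diag_grid (m n : nat) (a : 'I_m -> 'I_n -> R) : 'M[R]_#|dof m n| :=
  diag_mx (\row_c let: (i, j, _) := (enum_val c : dof m n) in a i j).

(* kap lists the eigenvalues of A with their algebraic multiplicities. *)
Definition eigenvalues_of (n : nat) (A : 'M[R]_n) (kap : 'I_n -> R) : Prop :=
  char_poly A = \prod_j ('X - (kap j)%:P).

Definition max_sqrt (n : nat) (kap : 'I_n -> R) : R :=
  \big[Num.max/0]_j Num.sqrt (kap j).

Definition sym_psd_form (m n : nat) (S : gridfun m n -> gridfun m n -> R) : Prop :=
  [/\ forall v, scalar (S v),
      forall u v, S u v = S v u
    & forall u, 0 <= S u u].

End GridFunctions.

(* Nr, Ns (resp. Mr, Ms) are the numbers of grid intervals of the fine (resp.
   coarse) grid in the directions r and s: n_1^h = Nr.+1, n_2^h = Ns.+1,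
   n_1^{2h} = Mr.+1, n_2^{2h} = Ms.+1. *)
Record discretization (R : realType) (Nr Ns Mr Ms : nat) := Discretization {
  h1 : R;
  h2 : R;
  domc : subdomain R;
  domf : subdomain R;
  opf1 : line_op R Nr Nr.+1;
  opf2 : line_op R Ns Ns.+1;
  opc1 : line_op R Mr Mr.+1;
  opc2 : line_op R Ms Ms.+2;
  Pmx : 'M[R]_(Nr.+1, Mr.+1);
  Rmx : 'M[R]_(Mr.+1, Nr.+1)
}.

Section Discrete.
Variables (R : realType) (Nr Ns Mr Ms : nat).
Variable d : discretization R Nr Ns Mr Ms.

Notation h1 := (h1 d).
Notation h2 := (h2 d).

Definition fgrid := gridfun R Nr.+1 Ns.+1.
Definition cgrid := gridfun R Mr.+1 Ms.+1.
(* Coarse grid functions with the ghost line, which has index ord_max. *)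
Definition cgridg := gridfun R Mr.+1 Ms.+2.

Definition inner_idx : 'I_Ms.+1 -> 'I_Ms.+2 := widen_ord (leqnSn Ms.+1).
Definition noghost (c : cgridg) : cgrid := fun i j => c i (inner_idx j).

Definition fpt (i : 'I_Nr.+1) (j : 'I_Ns.+1) : 'rV[R]_2 :=
  \row_(k < 2) (if k == 0 then i%:R * h1 else j%:R * h2).
Definition cpt (i : 'I_Mr.+1) (j : 'I_Ms.+1) : 'rV[R]_2 :=
  \row_(k < 2) (if k == 0 then i%:R * (2 * h1) else j%:R * (2 * h2)).

Definition Jf i j := Jac (domf d) (fpt i j).
Definition Jc i j := Jac (domc d) (cpt i j).
Definition rhof i j := rho (domf d) (fpt i j).
Definition rhoc i j := rho (domc d) (cpt i j).
Definition Jrhof i j := rhof i j * Jf i j.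
Definition Jrhoc i j := rhoc i j * Jc i j.
Definition Nf k l i j := Nmat (domf d) k l (fpt i j).
Definition Nc k l i j := Nmat (domc d) k l (cpt i j).

Definition JLf i := Jf i ord0 * Lam (domf d) (fpt i ord0).
Definition JLc i := Jc i ord_max * Lam (domc d) (cpt i ord_max).

Definition wf i j := wt (opf1 d) 0 i * wt (opf2 d) 0 j.
Definition wc i j := wt (opc1 d) 0 i * wt (opc2 d) 0 j.

Definition ipf (v u : fgrid) : R :=
  h1 * h2 * \sum_i \sum_j wf i j * Jf i j * dot2 (v i j) (u i j).
Definition ipc (v u : cgrid) : R :=
  4 * h1 * h2 * \sum_i \sum_j wc i j * Jc i j * dot2 (v i j) (u i j).
Definition ipGf (u v : linefun R Nr.+1) : R :=
  h1 * \sum_i wt (opf1 d) 0 i * JLf i * dot2 (u i) (v i).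
Definition ipGc (u v : linefun R Mr.+1) : R :=
  2 * h1 * \sum_i wt (opc1 d) 0 i * JLc i * dot2 (u i) (v i).

Definition ftrace (f : fgrid) : linefun R Nr.+1 := fun i => f i ord0.
Definition ctrace (c : cgrid) : linefun R Mr.+1 := fun i => c i ord_max.

Definition Lf (f : fgrid) : fgrid := fun i j =>
  Gmat1 (G (opf1 d)) (Nf 0 0) f i j
  + Gmat2 (G (opf2 d)) (Nf 1 1) f i j
  + along1 (D (opf1 d)) (matmul (Nf 0 1) (along2 (D (opf2 d)) f)) i j
  + along2 (D (opf2 d)) (matmul (Nf 1 0) (along1 (D (opf1 d)) f)) i j.

Definition Lc (c : cgridg) : cgrid := fun i j =>
  Gmat1 (G (opc1 d)) (Nc 0 0) (noghost c) i j
  + Gmat2 (G (opc2 d)) (Nc 1 1) c i j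
  + along1 (D (opc1 d)) (matmul (Nc 0 1) (along2 (D (opc2 d)) (noghost c))) i j
  + along2 (D (opc2 d)) (matmul (Nc 1 0) (along1 (D (opc1 d)) (noghost c))) i j.

Definition Af (f : fgrid) : linefun R Nr.+1 := fun i =>
  Nf 1 0 i ord0 *m along1 (D (opf1 d)) f i ord0
  + Nf 1 1 i ord0 *m (\sum_k b1 (opf2 d) 0 k *: f i k).

Definition Ac (c : cgridg) : linefun R Mr.+1 := fun i =>
  Nc 1 0 i ord_max *m along1 (D (opc1 d)) (noghost c) i ord_max
  + Nc 1 1 i ord_max *m (\sum_k bn (opc2 d) 0 k *: c i k).

Definition calP (u : linefun R Mr.+1) : linefun R Nr.+1 := fun i =>
  (Num.sqrt (JLf i))^-1 *: \sum_k Pmx d i k *: (Num.sqrt (JLc k) *: u k).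
Definition calR (u : linefun R Nr.+1) : linefun R Mr.+1 := fun i =>
  (Num.sqrt (JLc i))^-1 *: \sum_k Rmx d i k *: (Num.sqrt (JLf k) *: u k).

Definition eta (c : cgridg) (f : fgrid) : linefun R Nr.+1 := fun i =>
  Jrhof i ord0 *: calP (fun k => (Jrhoc k ord_max)^-1 *: Lc c k ord_max) i
  - Lf f i ord0.

Definition Lhat (c : cgridg) (f : fgrid) : fgrid := fun i j =>
  if j == ord0 then Lf f i j + eta c f i else Lf f i j.

Definition cont_solution (c : cgridg) (f : fgrid) : Prop :=
  forall i, ftrace f i = calP (ctrace (noghost c)) i.

Definition cont_traction (c : cgridg) (f : fgrid) : Prop :=
  forall i, (JLc i)^-1 *: Ac c i =
    calR (fun k => (JLf k)^-1 *:
            (Af f k - (h2 * wt (opf2 d) 0 ord0) *: eta c f k)) i.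

Definition interface_cond c f := cont_solution c f /\ cont_traction c f.

(* The interface is the side s = 1 of the coarse and s = 0 of the fine
   subdomain; the other sides are physical boundaries. *)
Definition discretization_ok : Prop :=
  [/\ [/\ h1 * Nr%:R = 1, h2 * Ns%:R = 1,
          2 * h1 * Mr%:R = 1 & 2 * h2 * Ms%:R = 1],
      [/\ subdomain_ok (domc d), subdomain_ok (domf d)
        & Xmap (domc d) @` side 1 = Xmap (domf d) @` side 0],
      is_sbp id h1 false false (opf1 d) /\ is_sbp id h2 true false (opf2 d),
      is_sbp id (2 * h1) false false (opc1 d) /\
      is_sbp inner_idx (2 * h2) false true (opc2 d)
    & forall (vf : 'cV[R]_Nr.+1) (vc : 'cV[R]_Mr.+1),
        h1 *: (vf^T *m diag_mx (wt (opf1 d)) *m Pmx d *m vc) =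
        (2 * h1) *: (vc^T *m diag_mx (wt (opc1 d)) *m Rmx d *m vf)].

Definition sbp_form_f (S : fgrid -> fgrid -> R) : Prop :=
  sym_psd_form S /\
  forall v u : fgrid,
    ipf v (fun i j => (Jf i j)^-1 *: Lf u i j) =
      - S v u - ipGf (ftrace v) (fun i => (JLf i)^-1 *: Af u i).

Definition sbp_form_c (S : cgrid -> cgrid -> R) : Prop :=
  sym_psd_form S /\
  forall (v : cgrid) (u : cgridg),
    ipc v (fun i j => (Jc i j)^-1 *: Lc u i j) =
      - S v (noghost u) + ipGc (ctrace v) (fun i => (JLc i)^-1 *: Ac u i).

Definition stiffness_f (S : fgrid -> fgrid -> R)
    (K : 'M[R]_#|dof Nr.+1 Ns.+1|) : Prop :=
  forall v u : fgrid,
    S v u = ipf v (fun i j => rhof i j *: unvec (K *m vec u) i j).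

Definition stiffness_c (S : cgrid -> cgrid -> R)
    (K : 'M[R]_#|dof Mr.+1 Ms.+1|) : Prop :=
  forall v u : cgrid,
    S v u = ipc v (fun i j => rhoc i j *: unvec (K *m vec u) i j).

Definition Kbar_f (K : 'M[R]_#|dof Nr.+1 Ns.+1|) :=
  diag_grid (fun i j => Num.sqrt (rhof i j * wf i j)) *m K
  *m diag_grid (fun i j => (Num.sqrt (rhof i j * wf i j))^-1).

Definition Kbar_c (K : 'M[R]_#|dof Mr.+1 Ms.+1|) :=
  diag_grid (fun i j => Num.sqrt (rhoc i j * wc i j)) *m K
  *m diag_grid (fun i j => (Num.sqrt (rhoc i j * wc i j))^-1).

(* One step from levels n-1 (index 0) and n (index 1) to n+1 (index 2). The
   ghost values of cs and c2 are only constrained by the traction conditions. *)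
Definition pc_step (dt : R) (c0 : cgridg) (f0 : fgrid) (c1 : cgridg) (f1 : fgrid)
    (c2 : cgridg) (f2 : fgrid) : Prop :=
  exists (cs : cgridg) (fs : fgrid),
    let ac : cgridg := fun i j =>
      (dt ^+ 2)^-1 *: (cs i j - 2 *: c1 i j + c0 i j) in
    let af : fgrid := fun i j =>
      (dt ^+ 2)^-1 *: (fs i j - 2 *: f1 i j + f0 i j) in
    [/\ (forall i j, noghost cs i j =
           2 *: noghost c1 i j - noghost c0 i j
           + (dt ^+ 2 / Jrhoc i j) *: Lc c1 i j) /\
        (forall i j, j != ord0 -> fs i j =
           2 *: f1 i j - f0 i j + (dt ^+ 2 / Jrhof i j) *: Lhat c1 f1 i j),
        cont_solution cs fs,
        cont_traction cs fs,
        (forall i j, noghost c2 i j =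
           noghost cs i j + (dt ^+ 4 / 12 / Jrhoc i j) *: Lc ac i j) /\
        (forall i j, j != ord0 -> f2 i j =
           fs i j + (dt ^+ 4 / 12 / Jrhof i j) *: Lhat ac af i j)
      & cont_solution c2 f2 /\ cont_traction c2 f2].

Definition numerical_solution (dt : R) (c : nat -> cgridg) (f : nat -> fgrid)
  : Prop :=
  [/\ interface_cond (c 0%N) (f 0%N), interface_cond (c 1%N) (f 1%N)
    & forall n, pc_step dt (c n) (f n) (c n.+1) (f n.+1) (c n.+2) (f n.+2)].

(* energy dt Sf Sc c0 f0 c1 f1 is E^{n+1/2} for the levels n (index 0) and
   n+1 (index 1). *)
Definition energy (dt : R) (Sf : fgrid -> fgrid -> R) (Sc : cgrid -> cgrid -> R)
    (c0 : cgridg) (f0 : fgrid) (c1 : cgridg) (f1 : fgrid) : R :=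
  let Dtf : fgrid := fun i j =>
    Num.sqrt (rhof i j) *: (dt^-1 *: (f1 i j - f0 i j)) in
  let Dtc : cgrid := fun i j =>
    Num.sqrt (rhoc i j) *: (dt^-1 *: (noghost c1 i j - noghost c0 i j)) in
  ipf Dtf Dtf + ipc Dtc Dtc
  + Sc (noghost c1) (noghost c0) + Sf f1 f0
  - dt ^+ 2 / 12 * ipf (fun i j => (Jf i j)^-1 *: Lhat c1 f1 i j)
                       (fun i j => (Jrhof i j)^-1 *: Lhat c0 f0 i j)
  - dt ^+ 2 / 12 * ipc (fun i j => (Jc i j)^-1 *: Lc c1 i j)
                       (fun i j => (Jrhoc i j)^-1 *: Lc c0 i j).

End Discrete.

(* Main.v *)
Require Import Defs.
From HB Require Import structures.
From mathcomp Require Import all_boot all_order all_algebra.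
From mathcomp Require Import all_classical all_reals all_analysis.
From mathcomp Require Import complex ring lra.

Set Implicit Arguments.
Unset Strict Implicit.
Unset Printing Implicit Defensive.

Import Order.TTheory GRing.Theory Num.Theory.
Local Open Scope ring_scope.

(** The energy of a pair of consecutive levels is nonnegative for a purely
    algebraic reason: it is a sum of squares once the two interface conditions
    hold at both levels, as they do at every level of a numerical solution.

    Put the fine and coarse parts together: write u = (f, c without ghosts),
    M for the inner product weighted by the density, S for the sum of the two
    stiffness forms, and a = (J_rho^-1 Lhat f, J_rho^-1 Ltilde c) for the
    discrete acceleration. Two facts connect a with u.

    - If v satisfies the continuity of solution and (c, f) the continuity of
      traction, then M(v, a) = - S(v, u) ([weak_form]). The two boundary terms
      left by summation by parts cancel: the correction eta changes the fine
      one from the traction A_2 f to A_2 f - h_2 omega_1 eta, the traction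
      condition expresses the coarse one through R of the same quantity, and R
      is adjoint to P on the interface ([interpolation_adjoint]).
    - The acceleration itself satisfies the continuity of solution, because eta
      is defined so that the fine acceleration on the interface is P of the
      coarse one ([Lhat_interface]). So a is an admissible v above.

    The time step restriction says that t S(v, v) <= M(v, v) with
    t = dt^2 / 12. Indeed K is similar to the matrix of S in coordinates that
    are orthonormal for M; that matrix is symmetric, so its quadratic form is
    bounded by its largest eigenvalue ([stiffness_le], [rayleigh_le]). The
    matrices K-bar of the time step restriction are similar to K as well, so
    they have the same eigenvalues ([char_poly_conj]).

    For two levels with u = u0, u1 and a = a0, a1, let w = u1 - u0,
    s = u1 + u0, b = a1 - a0 and z = a1 + a0. Polarizing the energy and
    completing two squares, with M(w, b) = - S(w, w) and M(z, z) = - S(z, s),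
    gives
      E = M(w/dt + dt b/8, w/dt + dt b/8) + (t/16) M(b, b)
          + (1/4) S(s + t z, s + t z) + (t/4) (M(z, z) - t S(z, z)),
    a sum of nonnegative terms ([energy_ge0]). *)

(** * Rayleigh quotients of symmetric matrices *)

Lemma char_poly_conj (R : comNzRingType) (n : nat) (U V A : 'M[R]_n) :
  U *m V = 1%:M -> char_poly (U *m A *m V) = char_poly A.
Proof.
move=> UV1; rewrite /char_poly /char_poly_mx.
have UVP : map_mx polyC U *m map_mx polyC V = 1%:M by rewrite -map_mxM UV1 map_mx1.
have -> : 'X%:M - map_mx polyC (U *m A *m V) =
    map_mx polyC U *m ('X%:M - map_mx polyC A) *m map_mx polyC V.
  by rewrite mulmxBr mulmxBl mul_mx_scalar -scalemxAl UVP scale_scalar_mx mulr1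
             !map_mxM.
by rewrite !det_mulmx mulrAC -det_mulmx UVP det1 mul1r.
Qed.

(** Over the complex extension R[i] a real symmetric matrix is Hermitian, hence
    unitarily diagonalizable; its diagonal entries are eigenvalues, so by
    hypothesis they are among the [kap j]. *)
Lemma rayleigh_le (R : rcfType) (n : nat) (A : 'M[R]_n) (kap : 'I_n -> R) (k : R)
    (x : 'cV[R]_n) :
  A^T = A -> char_poly A = \prod_j ('X - (kap j)%:P) -> (forall j, kap j <= k) ->
  (x^T *m A *m x) 0 0 <= k * (x^T *m x) 0 0.
Proof.
move=> Asym Achar kap_le.
pose toC := @real_complex R; pose AC := map_mx toC A; pose xC := map_mx toC x.
have toC_conj m p (B : 'M[R]_(m, p)) :
    map_mx toC B^T = map_mx Num.conj ((map_mx toC B)^T).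
  apply/matrixP=> i j; rewrite !mxE; apply/esym/conj_Creal.
  by rewrite complex_real.
have ACherm : AC \is hermsymmx.
  by apply/is_hermitianmxP; rewrite expr0 scale1r -toC_conj Asym.
have /orthomx_spectralP := hermitian_normalmx ACherm.
set P := spectralmx AC; set D := spectral_diag AC => ACE.
have Pu : P \is unitarymx := spectral_unitarymx AC.
have Punit : P \in unitmx := spectral_unit AC.
have PAC : P *m AC = diag_mx D *m P by rewrite ACE !mulmxA mulmxV ?mul1mx.
have D_le i : D 0 i <= toC k.
  have : eigenvalue AC (D 0 i).
    apply/eigenvalueP; exists (row i P).
      by rewrite -row_mul PAC mul_diag_mx; apply/rowP=> j; rewrite !mxE.
    apply/eqP => Pi0; have : row i (P *m invmx P) = 0 by rewrite row_mul Pi0 mul0mx.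
    rewrite mulmxV // => /matrixP /(_ 0 i); rewrite !mxE eqxx => /eqP.
    by rewrite oner_eq0.
  rewrite eigenvalue_root_char -map_char_poly Achar rmorph_prod /=.
  rewrite /root horner_prod => /eqP/eqP; rewrite prodf_seq_eq0.
  case/hasP => j _ /=; rewrite rmorphB /= map_polyX map_polyC !hornerE subr_eq0.
  by move/eqP ->; rewrite lecR.
pose y := P *m xC.
have quadE : toC (k * (x^T *m x) 0 0 - (x^T *m A *m x) 0 0) =
    \sum_i (toC k - D 0 i) * `|y i 0| ^+ 2.
  have -> : k * (x^T *m x) 0 0 - (x^T *m A *m x) 0 0 =
      (x^T *m (k%:M - A) *m x) 0 0.
    by rewrite mulmxBr mulmxBl mul_mx_scalar -scalemxAl !mxE.
  transitivity ((map_mx toC (x^T *m (k%:M - A) *m x)) 0 0); first by rewrite [RHS]mxE.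
  rewrite !map_mxM toC_conj map_mxB map_scalar_mx -/AC -/xC.
  have -> : (toC k)%:M - AC =
      map_mx Num.conj P^T *m diag_mx (const_mx (toC k) - D) *m P.
    rewrite linearB /= diag_const_mx mulmxBr mulmxBl mul_mx_scalar -scalemxAl.
    by rewrite -invmx_unitary // mulVmx // scalemx1 -ACE.
  have -> : map_mx Num.conj xC^T *m
        (map_mx Num.conj P^T *m diag_mx (const_mx (toC k) - D) *m P) *m xC =
      map_mx Num.conj y^T *m (diag_mx (const_mx (toC k) - D) *m y).
    by rewrite /y trmx_mul map_mxM !mulmxA.
  clearbody y; rewrite mxE; apply: eq_bigr => i _.
  by rewrite mul_diag_mx !mxE normCK mulrCA [y i 0 * _]mulrC.
rewrite -subr_ge0 -(@lecR R) [X in _ <= X]quadE.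
by apply: sumr_ge0 => i _; rewrite mulr_ge0 ?exprn_ge0 // subr_ge0.
Qed.

(** A matrix which is self-adjoint for the inner product with weights q becomes
    symmetric after conjugation by the square root of q. Its eigenvalues may be
    read off any other conjugate U K V: the weights of [Kbar_f] and [Kbar_c]
    lack the Jacobian, so they differ from those that symmetrize K. *)
Lemma weighted_rayleigh_le (R : rcfType) (n : nat) (K U V : 'M[R]_n) (q : 'rV[R]_n)
    (kap : 'I_n -> R) (k : R) (x : 'cV[R]_n) :
  (forall i, 0 < q 0 i) -> (diag_mx q *m K)^T = diag_mx q *m K ->
  U *m V = 1%:M -> char_poly (U *m K *m V) = \prod_j ('X - (kap j)%:P) ->
  (forall j, kap j <= k) ->
  (x^T *m diag_mx q *m K *m x) 0 0 <= k * (x^T *m diag_mx q *m x) 0 0.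
Proof.
move=> q_gt0 qK_sym UV1; rewrite char_poly_conj // => Kchar kap_le.
pose s : 'rV[R]_n := \row_i Num.sqrt (q 0 i); pose t : 'rV[R]_n := \row_i (s 0 i)^-1.
have s_gt0 i : 0 < s 0 i by rewrite mxE sqrtr_gt0.
have ts1 : diag_mx t *m diag_mx s = 1%:M.
  apply/matrixP=> i j; rewrite mul_diag_mx !mxE.
  case: eqP => _; last by rewrite !mulr0n mulr0.
  by rewrite !mulr1n mulVf // gt_eqF // sqrtr_gt0.
have ss : diag_mx s *m diag_mx s = diag_mx q.
  apply/matrixP=> i j; rewrite mul_diag_mx !mxE.
  case: eqP => _; last by rewrite !mulr0n mulr0.
  by rewrite !mulr1n -expr2 sqr_sqrtr // ltW.
have st1 : diag_mx s *m diag_mx t = 1%:M by rewrite diag_mxC ts1.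
pose A := diag_mx s *m K *m diag_mx t.
have A_sym : A^T = A.
  have -> : A = diag_mx t *m (diag_mx q *m K) *m diag_mx t.
    by rewrite -ss !mulmxA ts1 mul1mx.
  by rewrite !trmx_mul tr_diag_mx -[in LHS]trmx_mul qK_sym mulmxA.
have A_char : char_poly A = \prod_j ('X - (kap j)%:P).
  by rewrite char_poly_conj ?Kchar.
have := rayleigh_le (diag_mx s *m x) A_sym A_char kap_le.
by rewrite /A trmx_mul tr_diag_mx !mulmxA -(mulmxA _ (diag_mx t)) ts1 mulmx1
           -!(mulmxA _ (diag_mx s) (diag_mx s)) ss.
Qed.

Lemma delta_mx_form (R : pzRingType) (m n : nat) (A : 'M[R]_(m, n)) (i : 'I_m) (k : 'I_n) :
  ((delta_mx i 0 : 'cV[R]_m)^T *m A *m (delta_mx k 0 : 'cV[R]_n)) 0 0 = A i k.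
Proof. by rewrite trmx_delta -rowE -colE !mxE. Qed.

Lemma trmx_form_sym (R : comNzRingType) (n : nat) (B : 'M[R]_n) :
  (forall x y : 'cV[R]_n, (x^T *m B *m y) 0 0 = (y^T *m B *m x) 0 0) -> B^T = B.
Proof. by move=> Bsym; apply/matrixP=> i j; rewrite mxE -[LHS]delta_mx_form -[RHS]delta_mx_form. Qed.

(** * Weighted inner products of grid functions *)

Section GridForm.
Variables (R : realType) (m n : nat).
Implicit Types (u v : gridfun R m n) (a b : 'I_m -> 'I_n -> R).

Definition gridform a v u : R := \sum_i \sum_j a i j * dot2 (v i j) (u i j).

Lemma dot2E (x y : 'cV[R]_2) : dot2 x y = \sum_p x p 0 * y p 0.
Proof. by rewrite /dot2 mxE; apply: eq_bigr => p _; rewrite mxE. Qed.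

Lemma dot2C (x y : 'cV[R]_2) : dot2 x y = dot2 y x.
Proof. by rewrite !dot2E; apply: eq_bigr => p _; rewrite mulrC. Qed.

Lemma dot2Dr (x y z : 'cV[R]_2) : dot2 x (y + z) = dot2 x y + dot2 x z.
Proof. by rewrite /dot2 mulmxDr mxE. Qed.

Lemma dot2Br (x y z : 'cV[R]_2) : dot2 x (y - z) = dot2 x y - dot2 x z.
Proof. by rewrite /dot2 mulmxBr !mxE. Qed.

Lemma dot2Zr c (x y : 'cV[R]_2) : dot2 x (c *: y) = c * dot2 x y.
Proof. by rewrite /dot2 -scalemxAr mxE. Qed.

Lemma dot2Zl c (x y : 'cV[R]_2) : dot2 (c *: x) y = c * dot2 x y.
Proof. by rewrite dot2C dot2Zr dot2C. Qed.

Lemma dot2_sumr (I : finType) (x : 'cV[R]_2) (y : I -> 'cV[R]_2) :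
  dot2 x (\sum_k y k) = \sum_k dot2 x (y k).
Proof. by rewrite /dot2 mulmx_sumr summxE. Qed.

Lemma dot2_ge0 (x : 'cV[R]_2) : 0 <= dot2 x x.
Proof. by rewrite dot2E sumr_ge0 // => p _; rewrite -expr2 sqr_ge0. Qed.

Lemma gridform_psd a : (forall i j, 0 <= a i j) -> sym_psd_form (gridform a).
Proof.
move=> a_ge0; split=> [v c x y|u v|u].
- rewrite /gridform mulr_sumr -big_split; apply: eq_bigr => i _ /=.
  rewrite mulr_sumr -big_split; apply: eq_bigr => j _ /=.
  rewrite (_ : (c *: x + y) i j = c *: x i j + y i j) // dot2Dr dot2Zr.
  by rewrite mulrDr mulrCA.
- by apply: eq_bigr => i _; apply: eq_bigr => j _; rewrite dot2C.
- apply: sumr_ge0 => i _; apply: sumr_ge0 => j _.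
  by rewrite mulr_ge0 ?dot2_ge0.
Qed.

Lemma unvecK : cancel (@unvec R m n) (@vec R m n).
Proof.
move=> x; apply/colP=> c; rewrite mxE.
case E: (enum_val c) => [[i j] p]; rewrite mxE; congr (x _ 0).
by apply: enum_val_inj; rewrite enum_rankK E.
Qed.

Lemma gridform_vec a v u :
  gridform a v u = ((vec v)^T *m diag_grid a *m vec u) 0 0.
Proof.
rewrite -mulmxA mul_diag_mx mxE.
rewrite (reindex enum_rank) /=; last first.
  by apply: onW_bij; exact: enum_rank_bij.
rewrite /gridform pair_big.
under eq_bigr => ij _ do rewrite dot2E mulr_sumr.
rewrite pair_big; apply: eq_bigr => -[[i j] p] _ /=.
by rewrite !mxE enum_rankK /= mulrCA.
Qed.

Lemma diag_gridV a : (forall i j, a i j != 0) ->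
  diag_grid a *m diag_grid (fun i j => (a i j)^-1) = 1%:M.
Proof.
move=> a_neq0; apply/matrixP=> i j; rewrite mul_diag_mx !mxE.
case: eqP => _; last by rewrite !mulr0n mulr0.
by rewrite !mulr1n; case: (enum_val i) => [[k l] p]; rewrite mulfV.
Qed.

(** Negative eigenvalues are harmless: [Num.sqrt] sends them to 0. *)
Lemma le_max_sqrt_sqr k (kap : 'I_k -> R) j : kap j <= max_sqrt kap ^+ 2.
Proof.
apply: le_trans (_ : Num.sqrt (kap j) ^+ 2 <= _).
  by case: (leP 0 (kap j)) => [?|/ltW ?]; [rewrite sqr_sqrtr | rewrite ler0_sqrtr ?expr0n].
have le_m : Num.sqrt (kap j) <= max_sqrt kap by apply: le_bigmax.
by rewrite lerXn2r ?nnegrE ?(le_trans _ le_m) ?sqrtr_ge0.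
Qed.

(** The matrix K is self-adjoint for [gridform a], since it represents the
    symmetric form S in this inner product. *)
Lemma stiffness_le (S : gridfun R m n -> gridfun R m n -> R)
    (K : 'M[R]_#|dof m n|) a b (kap : 'I_#|dof m n| -> R) :
  (forall i j, 0 < a i j) -> (forall i j, b i j != 0) ->
  (forall v u, S v u = S u v) ->
  (forall v u, S v u = gridform a v (unvec (K *m vec u))) ->
  eigenvalues_of (diag_grid b *m K *m diag_grid (fun i j => (b i j)^-1)) kap ->
  forall v, S v v <= max_sqrt kap ^+ 2 * gridform a v v.
Proof.
move=> a_gt0 b_neq0 S_sym S_K K_char v.
have S_vec w u : S w u = ((vec w)^T *m (diag_grid a *m K) *m vec u) 0 0.
  by rewrite S_K gridform_vec unvecK !mulmxA.
rewrite S_vec gridform_vec mulmxA.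
apply: (weighted_rayleigh_le _ _ _ (diag_gridV b_neq0) K_char (le_max_sqrt_sqr _)).
  by move=> c; rewrite mxE; case: (enum_val c) => [[i j] p].
apply: trmx_form_sym => x y.
by rewrite -[x]unvecK -[y]unvecK -!S_vec.
Qed.

End GridForm.

(** The quotient is +oo when the largest eigenvalue is 0; then the claim holds
    for every time step. *)
Lemma dt_max_sqrt_le (R : realType) (dt s : R) : 0 <= dt -> 0 <= s ->
  (dt%:E <= (2 * Num.sqrt 3)%:E / s%:E)%E -> dt ^+ 2 / 12 * s ^+ 2 <= 1.
Proof.
move=> dt_ge0 s_ge0; have [->|s_neq0] := eqVneq s 0; first by rewrite expr0n mulr0.
have s_gt0 : 0 < s by rewrite lt_def s_neq0.
rewrite inver (negPf s_neq0) lee_pdivlMr // lee_fin => le_dts.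
have sq : (dt * s) ^+ 2 <= (2 * Num.sqrt 3) ^+ 2.
  by rewrite lerXn2r ?nnegrE ?mulr_ge0 ?sqrtr_ge0.
by move: sq; rewrite !exprMn sqr_sqrtr //; lra.
Qed.

(** * The energy identity *)

Section Energy.
Variable R : realFieldType.

(** The condition [sym_psd_form] over an arbitrary module, so that it also covers
    pairs of a fine and a coarse grid function. *)
Definition psd_form (V : lmodType R) (F : V -> V -> R) : Prop :=
  [/\ forall v, scalar (F v), forall u v, F u v = F v u & forall u, 0 <= F u u].

Section FormTheory.
Variables (V : lmodType R) (F : V -> V -> R).
Hypothesis F_psd : psd_form F.

Lemma psd_formDr u v w : F u (v + w) = F u v + F u w.
Proof. by case: F_psd => lin _ _; have := lin u 1 v w; rewrite scale1r mul1r. Qed.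

Lemma psd_form0r u : F u 0 = 0.
Proof. by apply/(addrI (F u 0)); rewrite -psd_formDr !addr0. Qed.

Lemma psd_formZr u k v : F u (k *: v) = k * F u v.
Proof.
by case: F_psd => lin _ _; have := lin u k v 0; rewrite psd_form0r !addr0.
Qed.

Lemma psd_formNr u v : F u (- v) = - F u v.
Proof. by rewrite -scaleN1r psd_formZr mulN1r. Qed.

Lemma psd_formC u v : F u v = F v u.
Proof. by case: F_psd. Qed.

Lemma psd_formDl u v w : F (v + w) u = F v u + F w u.
Proof. by rewrite !(psd_formC _ u) psd_formDr. Qed.

Lemma psd_formZl u k v : F (k *: v) u = k * F v u.
Proof. by rewrite !(psd_formC _ u) psd_formZr. Qed.

Lemma psd_formNl u v : F (- v) u = - F v u.
Proof. by rewrite !(psd_formC _ u) psd_formNr. Qed.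

Definition psd_formE := (psd_formDr, psd_formDl, psd_formNr, psd_formNl).

Lemma psd_form_ge0 u : 0 <= F u u.
Proof. by case: F_psd. Qed.

Lemma psd_form_sqr u k v :
  F (u + k *: v) (u + k *: v) = F u u + 2 * k * F u v + k ^+ 2 * F v v.
Proof.
by rewrite !psd_formE !(psd_formZl, psd_formZr) (psd_formC v u); ring.
Qed.

End FormTheory.

Definition pair_form (U V : lmodType R) (F : U -> U -> R) (H : V -> V -> R)
  (x y : (U * V)%type) : R := F x.1 y.1 + H x.2 y.2.

Lemma psd_pair_form (U V : lmodType R) (F : U -> U -> R) (H : V -> V -> R) :
  psd_form F -> psd_form H -> psd_form (pair_form F H).
Proof.
case=> [lF cF pF] [lH cH pH]; split=> [v k x y|u v|u]; rewrite /pair_form /=.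
- by rewrite lF lH mulrDr addrACA.
- by rewrite cF cH.
- by rewrite addr_ge0.
Qed.

(** Here a0, a1 are the accelerations that the displacements u0, u1 cause. The
    weak form is tested against these four vectors because M(w, b) and M(z, z),
    with w, b, z the differences and the sum of the overview, expand into
    exactly such terms. *)
Lemma energy_ge0 (V : lmodType R) (M S : V -> V -> R) (dt : R) (u0 u1 a0 a1 : V) :
  psd_form M -> psd_form S -> 0 < dt ->
  (forall v, dt ^+ 2 / 12 * S v v <= M v v) ->
  (forall v, v \in [:: u0; u1; a0; a1] -> M v a0 = - S v u0 /\ M v a1 = - S v u1) ->
  0 <= M (dt^-1 *: (u1 - u0)) (dt^-1 *: (u1 - u0)) + S u1 u0
       - dt ^+ 2 / 12 * M a1 a0.
Proof.
move=> M_psd S_psd dt_gt0 cfl weak.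
set t := dt ^+ 2 / 12 in cfl *.
have t_ge0 : 0 <= t by rewrite /t divr_ge0 ?exprn_ge0 // ltW.
pose w := u1 - u0; pose s := u1 + u0; pose b := a1 - a0; pose z := a1 + a0.
have inW : [/\ u0 \in [:: u0; u1; a0; a1], u1 \in [:: u0; u1; a0; a1],
    a0 \in [:: u0; u1; a0; a1] & a1 \in [:: u0; u1; a0; a1]].
  by rewrite !inE !eqxx !orbT.
case: inW => /weak[w00 w01] /weak[w10 w11] /weak[w20 w21] /weak[w30 w31].
have Mwb : M w b = - S w w.
  by rewrite /w /b !(psd_formE M_psd, psd_formE S_psd) w00 w01 w10 w11; ring.
have Mzz : M z z = - S z s.
  by rewrite /z /s !(psd_formE M_psd, psd_formE S_psd) w20 w21 w30 w31; ring.
have S10 : S u1 u0 = (S s s - S w w) / 4.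
  by rewrite /w /s !(psd_formE S_psd) (psd_formC S_psd u0 u1); field.
have M10 : M a1 a0 = (M z z - M b b) / 4.
  by rewrite /z /b !(psd_formE M_psd) (psd_formC M_psd a0 a1); field.
(* The weight dt / 8 produces the cross term - S w w / 4 of the energy, and its
   square costs (dt / 8)^2 = 3 t / 16, less than the available t / 4. *)
have Msq := psd_form_ge0 M_psd (dt^-1 *: w + (dt / 8) *: b).
rewrite (psd_form_sqr M_psd) (psd_formZl M_psd b) Mwb in Msq.
have dtc : 2 * (dt / 8) * (dt^-1 * - S w w) = - (S w w / 4).
  by field; rewrite gt_eqF.
have dt8 : (dt / 8) ^+ 2 = 3 / 16 * t by rewrite /t; field.
rewrite dtc dt8 in Msq.
(* The time step restriction enters only here, through t * S z z <= M z z. *)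
have Ssq := psd_form_ge0 S_psd (s + t *: z).
rewrite (psd_form_sqr S_psd) (psd_formC S_psd s z) in Ssq.
have Szs : S z s = - M z z by rewrite Mzz opprK.
have tcfl := ler_wpM2l t_ge0 (cfl z).
have tb := mulr_ge0 t_ge0 (psd_form_ge0 M_psd b).
rewrite -/w S10 M10; rewrite Szs in Ssq; move: Msq Ssq tcfl tb.
by rewrite expr2; lra.
Qed.

End Energy.

(** * Positivity of the discrete data *)

Section Interface.
Variables (R : realType) (Nr Ns Mr Ms : nat) (d : discretization R Nr Ns Mr Ms).
Hypothesis d_ok : discretization_ok d.

Lemma step_gt0 (N : nat) (h : R) : h * N%:R = 1 -> 0 < h.
Proof.
move=> hN1; have : 0 < h * N%:R by rewrite hN1.
by rewrite pmulr_lgt0 // lt_def ler0n andbT; apply: contra_eq_neq hN1 => ->;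
  rewrite mulr0 eq_sym oner_neq0.
Qed.

Lemma grid_point_itv (N : nat) (h : R) (i : 'I_N.+1) :
  h * N%:R = 1 -> 0 <= i%:R * h <= 1.
Proof.
move=> hN1; have h_gt0 := step_gt0 hN1.
apply/andP; split; first by rewrite mulr_ge0 // ltW.
by rewrite -[leRHS]hN1 mulrC ler_pM2l // ler_nat -ltnS.
Qed.

Lemma h1_gt0 : 0 < h1 d. Proof. by case: d_ok => -[/step_gt0]. Qed.
Lemma h2_gt0 : 0 < h2 d. Proof. by case: d_ok => -[_ /step_gt0]. Qed.

Lemma fpt_square i j : unit_square (fpt d i j).
Proof.
case: d_ok => -[h1N h2N _ _] _ _ _ _ k.
by rewrite mxE; case: eqP => _; apply: grid_point_itv.
Qed.

Lemma cpt_square i j : unit_square (cpt d i j).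
Proof.
case: d_ok => -[_ _ h1N h2N] _ _ _ _ k.
by rewrite mxE; case: eqP => _; apply: grid_point_itv.
Qed.

Lemma wf_gt0 i j : 0 < wf d i j.
Proof. by case: d_ok => _ _ [[w1 _ _ _ _] [w2 _ _ _ _]] _ _; rewrite mulr_gt0. Qed.

Lemma wc_gt0 i j : 0 < wc d i j.
Proof. by case: d_ok => _ _ _ [[w1 _ _ _ _] [w2 _ _ _ _]] _; rewrite mulr_gt0. Qed.

Lemma Jf_gt0 i j : 0 < Jf d i j.
Proof. by case: d_ok => _ [_ [_ _ ok] _] _ _ _; case: (ok _ (fpt_square i j)). Qed.

Lemma rhof_gt0 i j : 0 < rhof d i j.
Proof. by case: d_ok => _ [_ [_ _ ok] _] _ _ _; case: (ok _ (fpt_square i j)). Qed.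

Lemma Jc_gt0 i j : 0 < Jc d i j.
Proof. by case: d_ok => _ [[_ _ ok] _ _] _ _ _; case: (ok _ (cpt_square i j)). Qed.

Lemma rhoc_gt0 i j : 0 < rhoc d i j.
Proof. by case: d_ok => _ [[_ _ ok] _ _] _ _ _; case: (ok _ (cpt_square i j)). Qed.

Lemma JLf_gt0 i : 0 < JLf d i.
Proof.
case: d_ok => _ [_ [_ _ ok] _] _ _ _; case: (ok _ (fpt_square i ord0)) => J _ L _ _.
exact: mulr_gt0.
Qed.

Lemma JLc_gt0 i : 0 < JLc d i.
Proof.
case: d_ok => _ [[_ _ ok] _ _] _ _ _; case: (ok _ (cpt_square i ord_max)) => J _ L _ _.
exact: mulr_gt0.
Qed.

Definition massf i j : R := h1 d * h2 d * wf d i j * Jf d i j * rhof d i j.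
Definition massc i j : R := 4 * h1 d * h2 d * wc d i j * Jc d i j * rhoc d i j.

Lemma massf_gt0 i j : 0 < massf i j.
Proof.
have h12 := mulr_gt0 h1_gt0 h2_gt0.
exact: mulr_gt0 (mulr_gt0 (mulr_gt0 h12 (wf_gt0 i j)) (Jf_gt0 i j)) (rhof_gt0 i j).
Qed.

Lemma massc_gt0 i j : 0 < massc i j.
Proof.
have h12 : 0 < 4 * h1 d * h2 d by rewrite !mulr_gt0 ?h1_gt0 ?h2_gt0.
exact: mulr_gt0 (mulr_gt0 (mulr_gt0 h12 (wc_gt0 i j)) (Jc_gt0 i j)) (rhoc_gt0 i j).
Qed.

Lemma ipf_massE (v u : fgrid R Nr Ns) :
  ipf d v (fun i j => rhof d i j *: u i j) = gridform massf v u.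
Proof.
rewrite /ipf mulr_sumr; apply: eq_bigr => i _; rewrite mulr_sumr.
by apply: eq_bigr => j _; rewrite dot2Zr /massf; ring.
Qed.

Lemma ipc_massE (v u : cgrid R Mr Ms) :
  ipc d v (fun i j => rhoc d i j *: u i j) = gridform massc v u.
Proof.
rewrite /ipc mulr_sumr; apply: eq_bigr => i _; rewrite mulr_sumr.
by apply: eq_bigr => j _; rewrite dot2Zr /massc; ring.
Qed.

Lemma ipf_mass_sqrt (v : fgrid R Nr Ns) :
  ipf d (fun i j => Num.sqrt (rhof d i j) *: v i j)
        (fun i j => Num.sqrt (rhof d i j) *: v i j) = gridform massf v v.
Proof.
rewrite -ipf_massE /ipf; congr (_ * _); apply: eq_bigr => i _; apply: eq_bigr => j _.
by rewrite dot2Zl !dot2Zr [Num.sqrt _ * _]mulrA -expr2 sqr_sqrtr // ltW ?rhof_gt0.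
Qed.

Lemma ipfC (v u : fgrid R Nr Ns) : ipf d v u = ipf d u v.
Proof.
rewrite /ipf; congr (_ * _); apply: eq_bigr => i _; apply: eq_bigr => j _.
by rewrite dot2C.
Qed.

Lemma ipc_mass_sqrt (v : cgrid R Mr Ms) :
  ipc d (fun i j => Num.sqrt (rhoc d i j) *: v i j)
        (fun i j => Num.sqrt (rhoc d i j) *: v i j) = gridform massc v v.
Proof.
rewrite -ipc_massE /ipc; congr (_ * _); apply: eq_bigr => i _; apply: eq_bigr => j _.
by rewrite dot2Zl !dot2Zr [Num.sqrt _ * _]mulrA -expr2 sqr_sqrtr // ltW ?rhoc_gt0.
Qed.

Lemma ipcC (v u : cgrid R Mr Ms) : ipc d v u = ipc d u v.
Proof.
rewrite /ipc; congr (_ * _); apply: eq_bigr => i _; apply: eq_bigr => j _.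
by rewrite dot2C.
Qed.

(** * Cancellation of the interface terms *)

Lemma interpolation_compat i k :
  h1 d * (wt (opf1 d) 0 i * Pmx d i k) = 2 * h1 d * (wt (opc1 d) 0 k * Rmx d k i).
Proof.
case: d_ok => _ _ _ _ /(_ (delta_mx i 0) (delta_mx k 0)) /matrixP/(_ 0 0).
rewrite [LHS]mxE [RHS]mxE -!(mulmxA _ (diag_mx _)) !delta_mx_form.
by rewrite !mul_diag_mx !mxE.
Qed.

(** The scaling of P and R by square roots of J Lambda turns the compatibility
    condition into adjointness for the inner products on the interface, which
    contain the full factor J Lambda. *)
Lemma interpolation_adjoint (u : linefun R Mr.+1) (y : linefun R Nr.+1) :
  ipGf d (calP d u) y = ipGc d u (calR d y).
Proof.
pose s i := Num.sqrt (JLf d i); pose t k := Num.sqrt (JLc d k).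
have sqr_s i : JLf d i * (s i)^-1 = s i.
  by rewrite -{1}(sqr_sqrtr (ltW (JLf_gt0 i))) expr2 mulfK // gt_eqF ?sqrtr_gt0 ?JLf_gt0.
have sqr_t k : JLc d k * (t k)^-1 = t k.
  by rewrite -{1}(sqr_sqrtr (ltW (JLc_gt0 k))) expr2 mulfK // gt_eqF ?sqrtr_gt0 ?JLc_gt0.
transitivity (\sum_i \sum_k h1 d * (wt (opf1 d) 0 i * Pmx d i k) * s i * t k *
    dot2 (u k) (y i)).
  rewrite /ipGf mulr_sumr; apply: eq_bigr => i _.
  rewrite /calP dot2Zl dot2C dot2_sumr !mulr_sumr; apply: eq_bigr => k _.
  by rewrite !dot2Zr (dot2C (y i)) -[X in _ = _ * _ * X * _ * _]sqr_s /s /t; ring.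
rewrite exchange_big /ipGc mulr_sumr; apply: eq_bigr => k _ /=.
rewrite /calR dot2Zr dot2_sumr !mulr_sumr; apply: eq_bigr => i _.
by rewrite !dot2Zr interpolation_compat -[X in _ * _ * X * _ = _]sqr_t /s /t; ring.
Qed.

Lemma ipGf_JLf (u y : linefun R Nr.+1) :
  ipGf d u (fun i => (JLf d i)^-1 *: y i) =
  h1 d * \sum_i wt (opf1 d) 0 i * dot2 (u i) (y i).
Proof.
congr (_ * _); apply: eq_bigr => i _.
by rewrite dot2Zr mulrA mulfK // gt_eqF ?JLf_gt0.
Qed.

(** A correction y of the interface row is seen by the inner product on the
    domain with weight h_1 h_2 omega_i omega_1, and by the one on the interface
    with weight h_1 omega_i. *)
Lemma ipf_interface (v : fgrid R Nr Ns) (u : fgrid R Nr Ns) (y : linefun R Nr.+1) :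
  ipf d v (fun i j => (Jf d i j)^-1 *: (if j == ord0 then u i j + y i else u i j)) =
  ipf d v (fun i j => (Jf d i j)^-1 *: u i j) +
  ipGf d (ftrace v) (fun i => (JLf d i)^-1 *: ((h2 d * wt (opf2 d) 0 ord0) *: y i)).
Proof.
rewrite ipGf_JLf /ipf -mulrA -[X in _ = X + _]mulrA -mulrDr; congr (_ * _).
rewrite 2!mulr_sumr -big_split; apply: eq_bigr => i _ /=.
rewrite [in LHS](bigD1 ord0) //= [in RHS](bigD1 ord0) //=.
rewrite !mulrDr [RHS]addrAC; congr (_ + _).
  rewrite !dot2Zr dot2Dr /wf /ftrace; field.
  by rewrite gt_eqF ?Jf_gt0.
by congr (_ * _); apply: eq_bigr => j /negPf ->.
Qed.

(** This is what eta is for: adding it replaces the interface row of L^h f by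
    the value that makes accelerations continuous. *)
Lemma Lhat_interface c f i :
  (Jrhof d i ord0)^-1 *: Lhat d c f i ord0 =
  calP d (fun k => (Jrhoc d k ord_max)^-1 *: Lc d c k ord_max) i.
Proof.
have Jrho_neq0 : Jrhof d i ord0 != 0.
  by rewrite gt_eqF // mulr_gt0 ?rhof_gt0 ?Jf_gt0.
rewrite /Lhat eqxx /Defs.eta.
move: (Lf d f i ord0) (calP d _ i) (Jrhof d i ord0) Jrho_neq0 => x y q q_neq0.
by rewrite addrC subrK scalerA mulVf // scale1r.
Qed.

Section WeakForm.
Variables (Sf : fgrid R Nr Ns -> fgrid R Nr Ns -> R)
          (Sc : cgrid R Mr Ms -> cgrid R Mr Ms -> R).
Hypotheses (Sf_sbp : sbp_form_f d Sf) (Sc_sbp : sbp_form_c d Sc).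

(** Continuity of the test function lets its fine trace be moved to the coarse
    side by adjointness; there the traction condition for (c, f) identifies the
    two boundary terms of the summation by parts, which have opposite signs. *)
Lemma weak_form (vf : fgrid R Nr Ns) (vc : cgrid R Mr Ms) c f :
  (forall i, ftrace vf i = calP d (ctrace vc) i) -> cont_traction d c f ->
  ipf d vf (fun i j => (Jf d i j)^-1 *: Lhat d c f i j) +
  ipc d vc (fun i j => (Jc d i j)^-1 *: Lc d c i j) =
  - (Sf vf f + Sc vc (noghost c)).
Proof.
move=> v_cont traction.
rewrite ipf_interface (Sf_sbp.2 vf f) (Sc_sbp.2 vc c).
have -> : ipGc d (ctrace vc) (fun i => (JLc d i)^-1 *: Ac d c i) =
    ipGf d (ftrace vf) (fun k => (JLf d k)^-1 *:
            (Af d f k - (h2 d * wt (opf2 d) 0 ord0) *: Defs.eta d c f k)).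
  rewrite (_ : ftrace vf = calP d (ctrace vc)); last exact/funext.
  by rewrite interpolation_adjoint; congr (ipGc d _ _); apply/funext.
have -> : ipGf d (ftrace vf) (fun k => (JLf d k)^-1 *:
            (Af d f k - (h2 d * wt (opf2 d) 0 ord0) *: Defs.eta d c f k)) =
    ipGf d (ftrace vf) (fun k => (JLf d k)^-1 *: Af d f k) -
    ipGf d (ftrace vf) (fun k => (JLf d k)^-1 *:
            ((h2 d * wt (opf2 d) 0 ord0) *: Defs.eta d c f k)).
  rewrite !ipGf_JLf -mulrBr -sumrB; congr (_ * _); apply: eq_bigr => i _.
  by rewrite dot2Br mulrBr.
ring.
Qed.

End WeakForm.
End Interface.

(** * Nonnegativity of the energy *)

Lemma numerical_solution_interface (R : realType) (Nr Ns Mr Ms : nat)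
    (d : discretization R Nr Ns Mr Ms) (dt : R) c f :
  numerical_solution d dt c f -> forall n, interface_cond d (c n) (f n).
Proof.
case=> init0 init1 step [|[|n]]; [exact: init0 | exact: init1 |].
by case: (step n) => cs [fs [_ _ _ _ cond2]]; exact: cond2.
Qed.

Theorem theorem1 (R : realType) (Nr Ns Mr Ms : nat)
  (d : discretization R Nr Ns Mr Ms)
  (hd : discretization_ok d)
  (Sf : fgrid R Nr Ns -> fgrid R Nr Ns -> R)
  (Sc : cgrid R Mr Ms -> cgrid R Mr Ms -> R)
  (hSf : sbp_form_f d Sf) (hSc : sbp_form_c d Sc)
  (Kf : 'M[R]_#|dof Nr.+1 Ns.+1|) (Kc : 'M[R]_#|dof Mr.+1 Ms.+1|)
  (hKf : stiffness_f d Sf Kf) (hKc : stiffness_c d Sc Kc)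
  (kapf : 'I_#|dof Nr.+1 Ns.+1| -> R) (kapc : 'I_#|dof Mr.+1 Ms.+1| -> R)
  (hkapf : eigenvalues_of (Kbar_f d Kf) kapf)
  (hkapc : eigenvalues_of (Kbar_c d Kc) kapc)
  (dt : R) (dt_gt0 : 0 < dt)
  (c : nat -> cgridg R Mr Ms) (f : nat -> fgrid R Nr Ns)
  (hsol : numerical_solution d dt c f)
  (* division in the extended reals: x / 0 = +oo for 0 < x *)
  (hdt : (dt%:E <= Order.min
                     ((2 * Num.sqrt 3)%:E / (max_sqrt kapf)%:E)
                     ((2 * Num.sqrt 3)%:E / (max_sqrt kapc)%:E))%E)
  (n : nat) :
  0 <= energy d dt Sf Sc (c n) (f n) (c n.+1) (f n.+1).
Proof.
have mf_gt0 := massf_gt0 hd; have mc_gt0 := massc_gt0 hd.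
have [Sf_psd Sc_psd] : sym_psd_form Sf /\ sym_psd_form Sc by case: hSf; case: hSc.
have [cfl_f cfl_c] : dt ^+ 2 / 12 * max_sqrt kapf ^+ 2 <= 1 /\
    dt ^+ 2 / 12 * max_sqrt kapc ^+ 2 <= 1.
  have max_sqrt_ge0 k (kap : 'I_k -> R) : 0 <= max_sqrt kap by apply: bigmax_ge_id.
  by move: hdt; rewrite le_min => /andP[? ?]; split;
    apply: dt_max_sqrt_le => //; exact: ltW.
pose M := pair_form (gridform (massf d)) (gridform (massc d)).
pose S := pair_form Sf Sc.
have Mf_psd : psd_form (gridform (massf d)) by apply: gridform_psd => i j; exact: ltW.
have Mc_psd : psd_form (gridform (massc d)) by apply: gridform_psd => i j; exact: ltW.
have M_psd : psd_form M.
  exact: psd_pair_form Mf_psd Mc_psd.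
have S_psd : psd_form S by apply: psd_pair_form.
have Sf_le v : Sf v v <= max_sqrt kapf ^+ 2 * gridform (massf d) v v.
  apply: (stiffness_le (b := fun i j => Num.sqrt (rhof d i j * wf d i j)) _ _ _ _ hkapf) => //.
  - by move=> i j; rewrite gt_eqF // sqrtr_gt0 mulr_gt0 ?rhof_gt0 ?wf_gt0.
  - by case: Sf_psd.
  - by move=> u w; rewrite hKf ipf_massE.
have Sc_le v : Sc v v <= max_sqrt kapc ^+ 2 * gridform (massc d) v v.
  apply: (stiffness_le (b := fun i j => Num.sqrt (rhoc d i j * wc d i j)) _ _ _ _ hkapc) => //.
  - by move=> i j; rewrite gt_eqF // sqrtr_gt0 mulr_gt0 ?rhoc_gt0 ?wc_gt0.
  - by case: Sc_psd.
  - by move=> u w; rewrite hKc ipc_massE.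
have cfl v : dt ^+ 2 / 12 * S v v <= M v v.
  have t_ge0 : 0 <= dt ^+ 2 / 12 by rewrite divr_ge0 ?sqr_ge0.
  have scaled (s q k : R) : 0 <= q -> s <= k * q -> dt ^+ 2 / 12 * k <= 1 ->
      dt ^+ 2 / 12 * s <= q.
    move=> q_ge0 /(ler_wpM2l t_ge0) le_s le_1; apply: le_trans le_s _.
    by rewrite mulrA ler_piMl.
  rewrite mulrDr; apply: lerD.
    by apply: scaled (Sf_le _) cfl_f; apply: (psd_form_ge0 Mf_psd).
  by apply: scaled (Sc_le _) cfl_c; apply: (psd_form_ge0 Mc_psd).
pose u k : (fgrid R Nr Ns * cgrid R Mr Ms)%type := (f k, noghost (c k)).
pose a k : (fgrid R Nr Ns * cgrid R Mr Ms)%type :=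
  (fun i j => (Jrhof d i j)^-1 *: Lhat d (c k) (f k) i j,
   fun i j => (Jrhoc d i j)^-1 *: Lc d (c k) i j).
have rho_af k : (fun i j => rhof d i j *: (a k).1 i j) =
    (fun i j => (Jf d i j)^-1 *: Lhat d (c k) (f k) i j).
  apply/funext => i; apply/funext => j; rewrite scalerA invfM mulrA mulfV ?mul1r //.
  by rewrite gt_eqF ?rhof_gt0.
have rho_ac k : (fun i j => rhoc d i j *: (a k).2 i j) =
    (fun i j => (Jc d i j)^-1 *: Lc d (c k) i j).
  apply/funext => i; apply/funext => j; rewrite scalerA invfM mulrA mulfV ?mul1r //.
  by rewrite gt_eqF ?rhoc_gt0.
have interface := numerical_solution_interface hsol.
have weak (v : (fgrid R Nr Ns * cgrid R Mr Ms)%type) k :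
    (forall i, ftrace v.1 i = calP d (ctrace v.2) i) -> M v (a k) = - S v (u k).
  move=> v_cont; rewrite /M /pair_form -ipf_massE -ipc_massE rho_af rho_ac.
  exact: (weak_form hd hSf hSc v_cont (interface k).2).
(* Displacements are continuous by the interface conditions, accelerations by
   the choice of eta. *)
have weak01 v : v \in [:: u n; u n.+1; a n; a n.+1] ->
    M v (a n) = - S v (u n) /\ M v (a n.+1) = - S v (u n.+1).
  move=> v_in; suff v_cont i : ftrace v.1 i = calP d (ctrace v.2) i.
    by split; apply: weak.
  by move: v_in; rewrite !inE => /or4P[] /eqP ->;
    (exact: (interface _).1) || exact: Lhat_interface.
suff -> : energy d dt Sf Sc (c n) (f n) (c n.+1) (f n.+1) =
    M (dt^-1 *: (u n.+1 - u n)) (dt^-1 *: (u n.+1 - u n)) + S (u n.+1) (u n)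
    - dt ^+ 2 / 12 * M (a n.+1) (a n) by apply: energy_ge0.
rewrite /energy.
rewrite (ipf_mass_sqrt hd (dt^-1 *: (f n.+1 - f n))).
rewrite (ipc_mass_sqrt hd (dt^-1 *: (noghost (c n.+1) - noghost (c n)))).
rewrite -[X in ipf d X _]rho_af -[X in ipc d X _]rho_ac ipfC ipcC ipf_massE ipc_massE.
rewrite (psd_formC M_psd (a n.+1)) /M /S /pair_form mulrDr opprD !addrA.
by congr (_ - _ - _); rewrite addrAC.
Qed.
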